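(* Let $B$ be a barcode and let $c\ge 0$. Define the barcode $cB=\{[cb,cd):[b,d)\in B\}$ (as a multiset, with one bar $[cb,cd)$ for each bar $[b,d)$ of $B$). Then $$\mathrm{TSI}(cB)=c^2\,\mathrm{TSI}(B).$$
   Context: A barcode $B=\{[b_i,d_i)\}_{i=1}^{n^B}$ is a finite multiset of bars, each given by its pair of real endpoints $b_i\le d_i$ (zero-length bars are allowed); $n^B$ is the number of bars counted with multiplicity, $\ell_i=d_i-b_i\ge 0$ are the bar lengths (lifetimes), and $L^B=\sum_{i=1}^{n^B}\ell_i$ is the total persistence. The Topological Stability Index is the unbiased sample variance of the lifetimes: for $n^B\ge 2$, $$\mathrm{TSI}(B)=\frac{1}{n^B-1}\sum_{i=1}^{n^B}\left(\ell_i-\frac{L^B}{n^B}\right)^2,$$ and $\mathrm{TSI}(B)=0$ if $n^B\le 1$. *)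

(* Defs.v *)
From HB Require Import structures.
From mathcomp Require Import all_boot all_order all_algebra.
From mathcomp Require Import finmap multiset reals.

Set Implicit Arguments.
Unset Strict Implicit.
Unset Printing Implicit Defensive.

Import Order.TTheory GRing.Theory Num.Theory.
Local Open Scope ring_scope.

(* A bar is its pair of endpoints rather than the set [birth, death[, which is
   empty for every bar of length zero. *)
Record bar (R : realType) := Bar {
  endpoints : R * R;
  endpointsP : endpoints.1 <= endpoints.2 }.

HB.instance Definition _ (R : realType) := [isSub for @endpoints R].
HB.instance Definition _ (R : realType) := [Choice of bar R by <:].

Definition birth (R : realType) (x : bar R) : R := (endpoints x).1.
Definition death (R : realType) (x : bar R) : R := (endpoints x).2.
Definition lifetime (R : realType) (x : bar R) : R := death x - birth x.

Notation barcode R := {mset bar R}%mset.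

(* Through the coercion of a multiset to the sequence of its elements, each
   repeated according to its multiplicity, [size B] and the sums over [B]
   count bars with multiplicity. *)
Definition nbars (R : realType) (B : barcode R) : nat := size B.

Definition total_persistence (R : realType) (B : barcode R) : R :=
  \sum_(x <- B) lifetime x.

Definition TSI (R : realType) (B : barcode R) : R :=
  if (nbars B <= 1)%N then 0
  else ((nbars B)%:R - 1)^-1 *
    \sum_(x <- B) (lifetime x - total_persistence B / (nbars B)%:R) ^+ 2.

Definition scale_bar (R : realType) (c : R) (hc : 0 <= c) (x : bar R) : bar R :=
  @Bar R (c * birth x, c * death x) (ler_wpM2l hc (endpointsP x)).

(* The image is taken with multiplicity: bars that become equal after scaling
   (all of them reach [0, 0) when c = 0) have their multiplicities added. *)
Definition scale_barcode (R : realType) (c : R) (hc : 0 <= c) (B : barcode R) :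
    barcode R :=
  seq_mset [seq scale_bar hc x | x <- B].

(* Main.v *)
Require Import Defs.
From mathcomp Require Import all_boot all_order all_algebra.
From mathcomp Require Import finmap multiset reals.

(** The elements of the scaled barcode are a rearrangement of the scaled bars
    ([perm_scale_barcode]), so the number of bars is unchanged and every sum
    over the scaled barcode is a sum over the original one. Scaling multiplies
    each lifetime by [c], hence also their total and their mean; each deviation
    from the mean is therefore multiplied by [c] and its square by [c ^+ 2],
    which factors out of the sum. *)

Import Order.TTheory GRing.Theory Num.Theory.
Local Open Scope ring_scope.

Lemma perm_scale_barcode (R : realType) (c : R) (hc : 0 <= c) (B : barcode R) :
  perm_eq (scale_barcode hc B) [seq scale_bar hc x | x <- B].
Proof. exact: perm_eq_seq_mset. Qed.

Lemma nbars_scale (R : realType) (c : R) (hc : 0 <= c) (B : barcode R) :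
  nbars (scale_barcode hc B) = nbars B.
Proof. by rewrite /nbars (perm_size (perm_scale_barcode _ _ hc B)) size_map. Qed.

Lemma big_scale_barcode (R : realType) (c : R) (hc : 0 <= c) (B : barcode R)
    (F : bar R -> R) :
  \sum_(x <- scale_barcode hc B) F x = \sum_(x <- B) F (scale_bar hc x).
Proof. by rewrite (perm_big _ (perm_scale_barcode _ _ hc B)) big_map. Qed.

Lemma lifetime_scale (R : realType) (c : R) (hc : 0 <= c) (x : bar R) :
  lifetime (scale_bar hc x) = c * lifetime x.
Proof. by rewrite /lifetime mulrBr. Qed.

Lemma total_persistence_scale (R : realType) (c : R) (hc : 0 <= c)
    (B : barcode R) :
  total_persistence (scale_barcode hc B) = c * total_persistence B.
Proof.
rewrite /total_persistence big_scale_barcode mulr_sumr.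
by apply: eq_bigr => x _; rewrite lifetime_scale.
Qed.

Theorem proposition2p1 (R : realType) (B : barcode R) (c : R) (hc : 0 <= c) :
  TSI (scale_barcode hc B) = c ^+ 2 * TSI B.
Proof.
rewrite /TSI nbars_scale; case: ifP => _; first by rewrite mulr0.
rewrite total_persistence_scale big_scale_barcode mulrCA; congr (_ * _).
rewrite [RHS]mulr_sumr; apply: eq_bigr => x _.
by rewrite lifetime_scale -mulrA -mulrBr exprMn.
Qed.
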